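(* Let $d_1,d_2,d_3\ge2$, let $\rho$ be a density operator on $\mathbb{C}^{d_1}\otimes\mathbb{C}^{d_2}\otimes\mathbb{C}^{d_3}$, let $(f,g,h)$ be a permutation of $(1,2,3)$, and let $\alpha,\beta\in\mathbb{R}$. If $\rho$ is separable under the bipartition $f|gh$, then $$\|N^{f|gh}\|_{tr}\le\sqrt{d_f-1}\left(|\alpha|\sqrt{d_g-1}+|\beta|\sqrt{d_gd_h\Big(1-\frac{1}{d_g^2}-\frac{1}{d_h^2}\Big)+1}\right).$$
   Context: Generalized Pauli operators: for an integer $d\ge2$, let $\omega$ be a fixed primitive $d$-th root of unity and $E_{m,j}$ the $d\times d$ matrix units (indices modulo $d$). Writing $u\in\{0,\dots,d^2-1\}$ uniquely as $u=di+j$ with $0\le i,j\le d-1$, set $A_u=\sum_{m=0}^{d-1}\omega^{im}E_{m,m+j}$; so $A_0=I_d$ and $\operatorname{tr}(A_uA_v^\dagger)=d\delta_{uv}$. $A^{(s)}_u$ denotes these for $d=d_s$. The coefficients of $\rho$ are $t_{u_1,u_2,u_3}=\operatorname{tr}\big(\rho\,(A^{(1)}_{u_1})^\dagger\otimes(A^{(2)}_{u_2})^\dagger\otimes(A^{(3)}_{u_3})^\dagger\big)$, so $\rho=\frac{1}{d_1d_2d_3}\sum t_{u_1,u_2,u_3}A^{(1)}_{u_1}\otimes A^{(2)}_{u_2}\otimes A^{(3)}_{u_3}$. Matrices: for $(f,g,h)$ a permutation of $(1,2,3)$, $S^{f|g}$ is the $(d_f^2-1)\times(d_g^2-1)$ matrix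 with rows indexed by $u_f\in\{1,\dots,d_f^2-1\}$, columns by $u_g\in\{1,\dots,d_g^2-1\}$, whose entry is the coefficient $t_{u_1,u_2,u_3}$ with index $u_f$ in position $f$, $u_g$ in position $g$ and $0$ in position $h$. $S_0^{f|g}=[S^{f|g}\ \ O]$ is the $(d_f^2-1)\times(d_g^2-1)(d_h^2-1)$ matrix obtained by appending the $(d_f^2-1)\times(d_g^2-1)(d_h^2-2)$ zero matrix. $S^{f|gh}$ is the $(d_f^2-1)\times(d_g^2-1)(d_h^2-1)$ matrix with rows indexed by $u_f\ge1$ and columns by pairs $(u_g,u_h)$ with $u_g,u_h\ge1$ (lexicographic order), whose entry is the coefficient with $u_f,u_g,u_h$ in positions $f,g,h$. Finally $N^{f|gh}=\alpha S_0^{f|g}+\beta S^{f|gh}$. $\rho$ is separable under $f|gh$ if $\rho=\sum_s p_s\rho^s_f\otimes\rho^s_{gh}$ (finite sum) with $p_s>0$, $\sum_sp_s=1$, $\rho^s_f$ density operators on the $f$-th factor and $\rho^s_{gh}$ density operators on the remaining two factors. $\|X\|_{tr}=\operatorname{tr}\sqrt{XX^\dagger}$ is the trace norm (sum of singular values). *)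

(* Defs.v *)
From HB Require Import structures.
From mathcomp Require Import all_boot all_order all_algebra.
From mathcomp Require Import fingroup perm complex mxtens.
Set Implicit Arguments.
Unset Strict Implicit.
Unset Printing Implicit Defensive.
Import Order.TTheory GRing.Theory Num.Theory.
Local Open Scope ring_scope.

Section QDefs.
Variable C : numClosedFieldType.

Definition adjmx m n (X : 'M[C]_(m, n)) : 'M[C]_(n, m) := (map_mx Num.conj X)^T.

Definition psdmx n (M : 'M[C]_n) : Prop :=
  M = adjmx M /\ forall v : 'cV[C]_n, 0 <= (adjmx v *m M *m v) 0 0.

Definition density n (M : 'M[C]_n) : Prop := psdmx M /\ \tr M = 1.

(* "tr sqrt(X X^dagger) = t": Y is the (unique) positive semidefinite square
   root of X X^dagger and t is its trace. *)
Definition is_trace_norm m n (X : 'M[C]_(m, n)) (t : C) : Prop :=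
  exists Y : 'M[C]_m, psdmx Y /\ Y *m Y = X *m adjmx X /\ \tr Y = t.

(* generalized Pauli operator A_u, u = d*i + j:  A_u = sum_m w^(i m) E_{m,m+j} *)
Definition pauli (d : nat) (w : C) (u : nat) : 'M[C]_d :=
  \matrix_(m < d, n < d)
    (if (n : nat) == ((m + u %% d) %% d)%N then w ^+ (u %/ d * m) else 0).

Definition coef (d1 d2 d3 : nat) (w1 w2 w3 : C) (rho : 'M[C]_(d1 * d2 * d3))
    (u1 u2 u3 : nat) : C :=
  \tr (rho *m ((adjmx (pauli d1 w1 u1) *t adjmx (pauli d2 w2 u2))
                 *t adjmx (pauli d3 w3 u3))).

Definition dimk (d1 d2 d3 : nat) (k : nat) : nat := nth 0%N [:: d1; d2; d3] k.

(* coefficient with u_f, u_g, u_h in positions f = s 0, g = s 1, h = s 2 *)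
Definition coefp (d1 d2 d3 : nat) (w1 w2 w3 : C) (rho : 'M[C]_(d1 * d2 * d3))
    (s : 'S_3) (uf ug uh : nat) : C :=
  let upos (p : 'I_3) := if s 0 == p then uf else if s 1 == p then ug else uh in
  coef w1 w2 w3 rho (upos 0) (upos 1) (upos 2).

Section Mats.
Variables (d1 d2 d3 : nat) (w1 w2 w3 : C) (rho : 'M[C]_(d1 * d2 * d3)) (s : 'S_3).
Local Notation df := (dimk d1 d2 d3 (s 0)).
Local Notation dg := (dimk d1 d2 d3 (s 1)).
Local Notation dh := (dimk d1 d2 d3 (s 2)).
Local Notation t := (coefp w1 w2 w3 rho s).

Definition Sfg : 'M[C]_(df ^ 2 - 1, dg ^ 2 - 1) :=
  \matrix_(i, j) t i.+1 j.+1 0.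

Definition S0fg : 'M[C]_(df ^ 2 - 1, (dg ^ 2 - 1) * (dh ^ 2 - 1)) :=
  \matrix_(i, c) (if (c < dg ^ 2 - 1)%N then t i.+1 c.+1 0 else 0).

(* S^{f|gh}: columns are pairs (u_g, u_h), u_g,u_h >= 1, lexicographic *)
Definition Sfgh : 'M[C]_(df ^ 2 - 1, (dg ^ 2 - 1) * (dh ^ 2 - 1)) :=
  \matrix_(i, c) t i.+1 (mxtens_unindex c).1.+1 (mxtens_unindex c).2.+1.

Definition Nmat (alpha beta : C) : 'M[C]_(df ^ 2 - 1, (dg ^ 2 - 1) * (dh ^ 2 - 1)) :=
  alpha *: S0fg + beta *: Sfgh.

(* entry access with natural-number indices (always in range below) *)
Definition mxnat n (M : 'M[C]_n) (i j : nat) : C :=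
  match (insub i : option 'I_n), (insub j : option 'I_n) with
  | Some a, Some b => M a b
  | _, _ => 0
  end.

(* the k-th tensor component (k = 0,1,2) of a basis index of C^d1 (x) C^d2 (x) C^d3,
   with the Kronecker ordering of tensmx *)
Definition compk (k : nat) (x : 'I_(d1 * d2 * d3)) : nat :=
  let: (x12, x3) := mxtens_unindex x in
  let: (x1, x2) := mxtens_unindex x12 in
  nth 0%N [:: (x1 : nat); (x2 : nat); (x3 : nat)] k.

(* the operator A_f (x) B_{gh}, B acting on C^{d_g} (x) C^{d_h} (in that order),
   placed on the appropriate tensor factors *)
Definition prodop (A : 'M[C]_df) (B : 'M[C]_(dg * dh)) : 'M[C]_(d1 * d2 * d3) :=
  \matrix_(x, y)
    (mxnat A (compk (s 0) x) (compk (s 0) y) *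
     mxnat B (addn (muln (compk (s 1) x) dh) (compk (s 2) x))
             (addn (muln (compk (s 1) y) dh) (compk (s 2) y))).

Definition separable_fgh : Prop :=
  exists (n : nat) (p : 'I_n -> C) (A : 'I_n -> 'M[C]_df) (B : 'I_n -> 'M[C]_(dg * dh)),
    [/\ forall k, 0 < p k,
        \sum_k p k = 1,
        forall k, density (A k),
        forall k, density (B k)
      & rho = \sum_k p k *: prodop (A k) (B k)].

End Mats.
End QDefs.

(* Main.v *)
Require Import Defs.
From HB Require Import structures.
From mathcomp Require Import all_boot all_order all_algebra.
From mathcomp Require Import fingroup perm complex mxtens spectral.
From mathcomp Require Import ring.
Set Implicit Arguments.
Unset Strict Implicit.
Unset Printing Implicit Defensive.
Import Order.TTheory GRing.Theory Num.Theory.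
Local Open Scope ring_scope.

(* On a product state A (x) B the matrix N is a rank-one matrix a n^T, with a
   the traceless Pauli coefficients of A and n = alpha x + beta y, where x and y
   are the coefficients of B with trivial, resp. nontrivial, h-part; so by
   duality of the trace norm it suffices to bound the Euclidean norms of a, x
   and y. The Pauli operators form a tight frame, so Parseval gives
   |a|^2 = df Tr A^2 - 1 <= df - 1, the same for x with the g-marginal of B, and
   |y|^2 = dg dh Q - dg Pg - dh Ph + 1 for the purities Q, Pg, Ph of B and of
   its marginals. Since Q <= dh Pg and Q <= dg Ph, this is at most
   dg dh (1 - 1/dg^2 - 1/dh^2) Q + 1, and Q <= 1. *)


(** * Cauchy-Schwarz, purities of Gram kernels and their marginals, Parseval for tight frames *)

Section SumsOfSquares.
Variable C : numClosedFieldType.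

Lemma sum_normsq_ge0 (I : finType) (x : I -> C) : 0 <= \sum_i `|x i| ^+ 2.
Proof. by apply: sumr_ge0 => i _; rewrite exprn_ge0. Qed.

(** Lagrange's identity: twice the gap between the two sides is a double sum of squared moduli. *)
Lemma cauchy_schwarz_sum (I : finType) (x y : I -> C) :
  `|\sum_i x i * y i| ^+ 2 <= (\sum_i `|x i| ^+ 2) * (\sum_i `|y i| ^+ 2).
Proof.
have lagrange : \sum_i \sum_j `|x i * (y j)^* - x j * (y i)^*| ^+ 2 =
    ((\sum_i `|x i| ^+ 2) * (\sum_i `|y i| ^+ 2) - `|\sum_i x i * y i| ^+ 2) *+ 2.
  transitivity (\sum_i \sum_j (`|x i| ^+ 2 * `|y j| ^+ 2 + `|x j| ^+ 2 * `|y i| ^+ 2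
     - (x i * y i) * (x j * y j)^* - (x j * y j) * (x i * y i)^*)).
    apply: eq_bigr => i _; apply: eq_bigr => j _.
    rewrite !normCK !rmorphB !rmorphM /= !conjCK; ring.
  rewrite normCK rmorph_sum /= !big_distrlr /= mulrnBl !mulr2n.
  under eq_bigr do rewrite !sumrB big_split /=.
  rewrite !sumrB big_split /= opprD addrA.
  by congr (_ + _ - _ - _); rewrite exchange_big.
have : 0 <= \sum_i \sum_j `|x i * (y j)^* - x j * (y i)^*| ^+ 2.
  by apply: sumr_ge0 => i _; exact: sum_normsq_ge0.
by rewrite lagrange pmulrn_lge0 // subr_ge0.
Qed.

(** The squared Hilbert-Schmidt norm, which is [Tr r^2] when [r] is Hermitian. *)
Definition purity (E : finType) (r : E -> E -> C) : C := \sum_e \sum_f `|r e f| ^+ 2.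

(** A state as a sum of unnormalised pure states [x k]; in this form positivity needs no further
    proof. *)
Definition gram (K E : finType) (x : K -> E -> C) (e f : E) : C :=
  \sum_k x k e * (x k f)^*.

Lemma gram_diagE (K E : finType) (x : K -> E -> C) e :
  gram x e e = \sum_k `|x k e| ^+ 2.
Proof. by apply: eq_bigr => k _; rewrite normCK. Qed.

(** Entrywise, Cauchy-Schwarz bounds [|r e f|^2] by [r e e * r f f]. *)
Lemma purity_gram_le (K E : finType) (x : K -> E -> C) :
  purity (gram x) <= (\sum_e gram x e e) ^+ 2.
Proof.
rewrite /purity expr2 big_distrlr /=.
apply: ler_sum => e _; apply: ler_sum => f _; rewrite !gram_diagE.
apply: le_trans (cauchy_schwarz_sum _ _) _.
by under [X in _ * X <= _]eq_bigr do rewrite norm_conjC.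
Qed.

(** The two products of a matrix with its adjoint have the same Hilbert-Schmidt norm: both sides
    expand to one fourfold sum. *)
Lemma purity_gram_dual (K E : finType) (x : K -> E -> C) :
  purity (gram x) = purity (gram (fun e k => x k e)).
Proof.
pose T e f k l := x k e * (x k f)^* * ((x l e)^* * x l f).
transitivity (\sum_e \sum_f \sum_k \sum_l T e f k l).
  apply: eq_bigr => e _; apply: eq_bigr => f _.
  rewrite normCK rmorph_sum /= big_distrlr /=.
  by apply: eq_bigr => k _; apply: eq_bigr => l _; rewrite rmorphM /= conjCK.
transitivity (\sum_k \sum_l \sum_e \sum_f T e f k l).
  under eq_bigr do rewrite exchange_big.
  rewrite exchange_big; apply: eq_bigr => k _ /=.
  under eq_bigr do rewrite exchange_big.
  by rewrite exchange_big.
apply: eq_bigr => k _; apply: eq_bigr => l _.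
rewrite normCK rmorph_sum /= big_distrlr /=.
by apply: eq_bigr => e _; apply: eq_bigr => f _; rewrite rmorphM /= conjCK /T; ring.
Qed.

(* [Tr rho^2 <= dim F * Tr rho_E^2]: pass to the dual Gram kernel, where the
   left side is a sum of squared traces of [F x F] blocks whose entries make
   up the right side. *)
Lemma purity_gram_marginal (K E F : finType) (x : K -> E * F -> C) :
  purity (gram x) <=
  #|F|%:R * purity (gram (fun (kf : K * F) e => x kf.1 (e, kf.2))).
Proof.
rewrite purity_gram_dual [purity (gram (fun _ : K * F => _))]purity_gram_dual.
pose G (k l : K) (f g : F) := \sum_e x k (e, f) * (x l (e, g))^*.
have -> : purity (gram (fun e (kf : K * F) => x kf.1 (e, kf.2))) =
    \sum_k \sum_l \sum_f \sum_g `|G k l f g| ^+ 2.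
  rewrite /purity /gram.
  rewrite -(pair_bigA _ (fun k f => \sum_(q : K * F) `|G k q.1 f q.2| ^+ 2)) /=.
  apply: eq_bigr => k _; rewrite exchange_big /=.
  rewrite -(pair_bigA _ (fun l g => \sum_f `|G k l f g| ^+ 2)) /=.
  by apply: eq_bigr => l _; rewrite exchange_big.
rewrite /purity mulr_sumr; apply: ler_sum => k _.
rewrite mulr_sumr; apply: ler_sum => l _.
(* The factors [1] set up Cauchy-Schwarz against the constant vector, whose squared norm is [#|F|];
   off-diagonal block entries are then added for free. *)
have -> : gram (fun e k => x k e) k l = \sum_f 1 * G k l f f.
  under eq_bigr do rewrite mul1r.
  by rewrite exchange_big pair_bigA; apply: eq_bigr => -[].
apply: le_trans (cauchy_schwarz_sum _ _) _.
rewrite normr1 expr1n sumr_const; apply: ler_wpM2l; first exact: ler0n.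
apply: ler_sum => f _; rewrite (bigD1 f) //= lerDl.
by apply: sumr_ge0 => g _; rewrite exprn_ge0.
Qed.

(** Absorbing [F] into the label of the vectors is the partial trace, so a marginal is again a Gram
    kernel. *)
Lemma gram_marginalE (K E F : finType) (x : K -> E * F -> C) e e' :
  gram (fun (kf : K * F) e => x kf.1 (e, kf.2)) e e' =
  \sum_f gram x (e, f) (e', f).
Proof.
rewrite /gram -(pair_bigA _ (fun k f => x k (e, f) * (x k (e', f))^*)) /=.
by rewrite exchange_big.
Qed.

Definition tight_frame (I E : finType) (c : C) (F : I -> E -> C) :=
  forall e f, \sum_u F u e * (F u f)^* = c * (e == f)%:R.

Lemma parseval (I E : finType) (c : C) (F : I -> E -> C) (X : E -> C) :
  tight_frame c F ->
  \sum_u `|\sum_e X e * (F u e)^*| ^+ 2 = c * \sum_e `|X e| ^+ 2.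
Proof.
move=> tF.
transitivity (\sum_e \sum_f X e * (X f)^* * \sum_u F u f * (F u e)^*).
  under eq_bigr do rewrite normCK rmorph_sum /= big_distrlr /=.
  rewrite exchange_big; apply: eq_bigr => e _ /=.
  rewrite exchange_big; apply: eq_bigr => f _ /=.
  rewrite mulr_sumr; apply: eq_bigr => u _; rewrite rmorphM /= conjCK; ring.
rewrite mulr_sumr; apply: eq_bigr => e _.
rewrite (bigD1 e) //= [X in _ + X]big1 => [|f /negPf nfe]; last by rewrite tF nfe !mulr0.
by rewrite tF eqxx mulr1 addr0 normCK mulrC.
Qed.

End SumsOfSquares.


(** * Positive semidefinite matrices as Gram kernels, and duality for the trace norm *)

Section PositiveSemidefinite.
Variable C : numClosedFieldType.

Lemma adjmxE m n (X : 'M[C]_(m, n)) i j : adjmx X i j = (X j i)^*.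
Proof. by rewrite !mxE. Qed.

Lemma adjmxM m n p (X : 'M[C]_(m, n)) (Y : 'M_(n, p)) :
  adjmx (X *m Y) = adjmx Y *m adjmx X.
Proof. by rewrite /adjmx map_mxM trmx_mul. Qed.

Lemma adjmxB m n (X Y : 'M[C]_(m, n)) : adjmx (X - Y) = adjmx X - adjmx Y.
Proof. by apply/matrixP=> i j; rewrite !mxE rmorphB. Qed.

Lemma adjmxK m n (X : 'M[C]_(m, n)) : adjmx (adjmx X) = X.
Proof. by apply/matrixP=> i j; rewrite !adjmxE conjCK. Qed.

Lemma rownormE n (b : 'rV[C]_n) : (b *m adjmx b) 0 0 = \sum_j `|b 0 j| ^+ 2.
Proof. by rewrite mxE; apply: eq_bigr => j _; rewrite adjmxE normCK. Qed.

Lemma colnormE n (a : 'cV[C]_n) : (adjmx a *m a) 0 0 = \sum_i `|a i 0| ^+ 2.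
Proof. by rewrite mxE; apply: eq_bigr => j _; rewrite adjmxE normCK mulrC. Qed.

Lemma psdmx_spectral n (M : 'M[C]_n) : psdmx M ->
  exists (U : 'M[C]_n) (D : 'rV[C]_n),
    [/\ U *m adjmx U = 1%:M, adjmx U *m U = 1%:M, forall j, 0 <= D 0 j
      & M = adjmx U *m diag_mx D *m U].
Proof.
case=> Mherm Mge0.
have adjE p q (X : 'M[C]_(p, q)) : map_mx Num.conj X^T = adjmx X.
  by rewrite /adjmx map_trmx.
have /orthomx_spectralP Meq : M \is normalmx.
  by apply/normalmxP; rewrite !adjE -Mherm.
have Uu := spectral_unitarymx M; rewrite invmx_unitary // adjE in Meq.
move: Uu Meq; set U := spectralmx M; set D := spectral_diag M => /unitarymxP.
rewrite adjE => UU Meq; have UU' := mulmx1C UU.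
exists U, D; split=> // j.
(* Column [j] of [adjmx U] is a unit eigenvector, so the form takes the eigenvalue [D 0 j] there. *)
have := Mge0 (adjmx U *m delta_mx j 0).
rewrite Meq adjmxM adjmxK !mulmxA -(mulmxA _ U (adjmx U)) UU mulmx1.
rewrite -(mulmxA _ U (adjmx U)) UU mulmx1 mxE (bigD1 j) //= big1 => [|i ij].
  rewrite addr0 !mxE (bigD1 j) //= big1 => [|i ij]; last first.
    by rewrite !mxE (negPf ij) mulr0n mulr0.
  by rewrite !mxE !eqxx conjC1 mul1r mulr1 addr0 mulr1n.
by rewrite [X in _ * X]mxE (negPf ij) mulr0.
Qed.

(** The vectors are eigenvectors scaled by the square roots of their eigenvalues. *)
Lemma psdmx_gram n (M : 'M[C]_n) : psdmx M ->
  exists x : 'I_n -> 'I_n -> C, forall i j, M i j = gram x i j.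
Proof.
move=> /psdmx_spectral[U [D [_ _ Dge0 ->]]].
exists (fun k i => sqrtC (D 0 k) * (U k i)^*) => i j.
rewrite mxE; apply: eq_bigr => k _; rewrite mul_mx_diag mxE adjmxE rmorphM /= conjCK.
rewrite [(sqrtC _)^*]geC0_conj ?sqrtC_ge0 //.
by rewrite -[D 0 k in LHS]sqrtCK; ring.
Qed.

(** [W] is the adjoint of the partial isometry in the polar decomposition of [X]. With [W] fixed,
    [\tr (X *m W)] is linear in [X], so decomposing [X] calls only for the scalar triangle
    inequality. *)
Lemma trace_norm_dual m n (X : 'M[C]_(m, n)) t : is_trace_norm X t ->
  exists W : 'M[C]_(n, m), [/\ 0 <= t, t = \tr (X *m W) &
    forall (a : 'cV_m) (b : 'rV_n), `|\tr (a *m b *m W)| <=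
      sqrtC (\sum_i `|a i 0| ^+ 2) * sqrtC (\sum_j `|b 0 j| ^+ 2)].
Proof.
case=> Y [/psdmx_spectral[U [D [UU UU' Dge0 ->]]] [Ysq <-]] {Y}.
have {}Ysq : U *m (X *m adjmx X) *m adjmx U = diag_mx D *m diag_mx D.
  rewrite -Ysq !mulmxA UU mul1mx -(mulmxA _ U (adjmx U)) UU mulmx1.
  by rewrite -!mulmxA (mulmxA U) UU mul1mx.
pose E := \row_i (D 0 i)^-1.
have adjE : adjmx (diag_mx E) = diag_mx E.
  apply/matrixP => i j; rewrite adjmxE !mxE eq_sym.
  case: eqP => [->|_]; last by rewrite !mulr0n conjC0.
  by rewrite !mulr1n geC0_conj // invr_ge0.
(* [E] inverts [D] off its zeros, since [0^-1 = 0]. *)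
have DDE : diag_mx D *m diag_mx D *m diag_mx E = diag_mx D.
  rewrite !mulmx_diag; congr diag_mx; apply/rowP => i; rewrite !mxE.
  by have [->|nz] := eqVneq (D 0 i) 0; rewrite ?mul0r // mulfK.
(* The nonzero rows of [V] are orthonormal right singular vectors of [X]; row [i] vanishes where
   [D 0 i = 0]. *)
pose V := diag_mx E *m U *m X.
have VV : V *m adjmx V = diag_mx E *m diag_mx D.
  rewrite /V !adjmxM adjE -[in RHS]DDE -Ysq !mulmxA; congr (_ *m _).
have VVV : V *m adjmx V *m V = V.
  rewrite VV /V !mulmxA !mulmx_diag; congr (_ *m _ *m _).
  congr diag_mx; apply/rowP => i; rewrite !mxE.
  by have [->|nz] := eqVneq (D 0 i) 0; rewrite ?invr0 ?mul0r // mulVf ?mul1r.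
have trD : \tr (adjmx U *m diag_mx D *m U) = \tr (diag_mx D).
  by rewrite mxtrace_mulC mulmxA UU mul1mx.
exists (adjmx V *m U); split.
- by rewrite trD mxtrace_diag sumr_ge0.
- by rewrite trD -[in LHS]DDE -Ysq !adjmxM adjE !mulmxA [RHS]mxtrace_mulC !mulmxA.
(* By cyclicity the trace pairs [b *m adjmx V] with [U *m a]. After Cauchy-Schwarz, [U] preserves
   the norm of [a], and [adjmx V] does not increase that of [b]. *)
clearbody V => a b; have -> : \tr (a *m b *m (adjmx V *m U)) =
    \sum_i (b *m adjmx V) 0 i * (U *m a) i 0.
  by rewrite -mulmxA mxtrace_mulC mulmxA -[_ *m U *m a]mulmxA trace_mx11 mxE.
rewrite -(@ler_pXn2r _ 2%N) ?nnegrE ?mulr_ge0 ?sqrtC_ge0 ?sum_normsq_ge0 //.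
apply: le_trans (cauchy_schwarz_sum _ _) _.
rewrite exprMn !sqrtCK mulrC; apply: ler_pM; rewrite ?sum_normsq_ge0 //.
  by rewrite -!colnormE adjmxM -mulmxA (mulmxA (adjmx U)) UU' mul1mx.
(* Bessel: [|b|^2 - |b V^dagger|^2 = |b - b V^dagger V|^2], as [V] is a partial
   isometry. *)
have := sum_normsq_ge0 (fun j => (b - b *m adjmx V *m V) 0 j).
rewrite -!rownormE -[X in _ -> is_true X]subr_ge0.
suff -> : (b - b *m adjmx V *m V) *m adjmx (b - b *m adjmx V *m V) =
   b *m adjmx b - b *m adjmx V *m adjmx (b *m adjmx V).
  by rewrite !mxE.
have -> : adjmx (b - b *m adjmx V *m V) = adjmx b - adjmx V *m (V *m adjmx b).
  by rewrite adjmxB !adjmxM adjmxK.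
rewrite !adjmxM adjmxK mulmxBr !mulmxBl !mulmxA.
have -> : b *m adjmx V *m V *m adjmx V = b *m adjmx V.
  have := congr1 (fun Z => b *m adjmx Z) VVV; rewrite !adjmxM adjmxK !mulmxA.
  by [].
by rewrite subrr subr0.
Qed.
End PositiveSemidefinite.


(** * Pauli operators as a tight frame, and sums of squared coefficients in one and two factors *)

Section PauliCoefficients.
Variable C : numClosedFieldType.

Lemma pauli0E d (w : C) (m n : 'I_d) : pauli d w 0 m n = (n == m)%:R.
Proof.
rewrite mxE mod0n addn0 modn_small // div0n mul0n expr0.
by rewrite -val_eqE; case: eqP.
Qed.

(** Orthogonality of characters: since [|w| = 1], conjugation inverts, leaving a geometric sum whose
    ratio [z] satisfies [z^d = 1]. *)
Lemma sum_expr_prim_root d (w : C) (m n : 'I_d) : d.-primitive_root w ->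
  \sum_(i < d) w ^+ (i * m) * (w ^+ (i * n))^* = d%:R * (m == n)%:R.
Proof.
move=> w_prim; have d_gt0 : (0 < d)%N by exact: leq_ltn_trans (ltn_ord m).
have w_norm : `|w| = 1.
  apply/eqP; rewrite -(@pexpr_eq1 _ _ d) // -normrX.
  by rewrite (prim_expr_order w_prim) normr1.
have w_conj k : (w ^+ k)^* = (w ^+ k)^-1.
  by rewrite invC_norm normrX w_norm !expr1n invr1 mul1r.
have wX_neq0 k : w ^+ k != 0 by rewrite -normr_gt0 normrX w_norm expr1n.
pose z := w ^+ m / w ^+ n.
transitivity (\sum_(i < d) z ^+ i).
  apply: eq_bigr => i _.
  by rewrite w_conj expr_div_n -!exprM ![(_ * i)%N]mulnC.
have [eq_mn|neq_mn] := eqVneq m n.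
  rewrite mulr1 /z eq_mn; under eq_bigr do rewrite divff // expr1n.
  by rewrite sumr_const card_ord.
have z_neq1 : z - 1 != 0.
  rewrite subr_eq0 /z -(can_eq (mulfK (wX_neq0 n))) mul1r divfK //.
  by rewrite (eq_prim_root_expr w_prim) !modn_small.
apply: (mulfI z_neq1); rewrite -subrX1 !mulr0 expr_div_n -!exprM.
by rewrite ![(_ * d)%N]mulnC !exprM (prim_expr_order w_prim) !expr1n divr1 subrr.
Qed.

Lemma mxtens_index_bij m n : bijective (@mxtens_index m n).
Proof.
by exists (@mxtens_unindex m n); [exact: mxtens_indexK | exact: mxtens_unindexK].
Qed.

(** With [u = d i + j], the sum over the phase [i] forces equal rows, and the sum over the shift [j]
    then forces equal columns. *)
Lemma pauli_tight_frame d (w : C) : d.-primitive_root w ->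
  tight_frame d%:R (fun (u : 'I_(d * d)) (e : 'I_d * 'I_d) => pauli d w u e.1 e.2).
Proof.
move=> w_prim [m n] [m' n'] /=.
rewrite (reindex _ (onW_bij _ (mxtens_index_bij d d))) /=.
pose T (i j : 'I_d) : C :=
  ((n == (m + j) %% d :> nat) && (n' == (m' + j) %% d :> nat))%N%:R *
  (w ^+ (i * m) * (w ^+ (i * m'))^*).
transitivity (\sum_i \sum_j T i j).
  rewrite (pair_bigA _ T); apply: eq_bigr => -[i j] _ /=.
  have d_gt0 : (0 < d)%N by exact: leq_ltn_trans (ltn_ord m).
  rewrite !mxE /= modnMDl divnMDl // divn_small // addn0 [(j %% d)%N]modn_small // /T.
  by case: eqP; case: eqP => *; rewrite ?conjC0 ?mul0r ?mulr0 ?mul1r.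
rewrite exchange_big /=; under eq_bigr do rewrite -mulr_sumr sum_expr_prim_root //.
rewrite -mulr_suml mulrC -mulrA xpair_eqE; congr (_ * _).
case: eqP => [<-|_]; last by rewrite mul0r.
rewrite mul1r; have [<-|neq_n] := eqVneq n n'; last first.
  rewrite big1 //= => j _; case: andP => // -[/eqP En /eqP En'].
  by case/eqP: neq_n; apply: val_inj; rewrite /= En.
(* A successor dimension gives the ordinals their additive group, in which the only contributing
   shift is [n - m]. *)
case: d => [[]//|d] in m n {w w_prim m' n' T} *.
have shift (j : 'I_d.+1) : (n == (m + j) %% d.+1 :> nat)%N = (j == n - m)%R.
  by rewrite [RHS]eq_sym subr_eq addrC.
rewrite (bigD1 (n - m)%R) // big1 => [|j /negPf neq_j].
  by rewrite andbb shift eqxx /= addr0.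
by rewrite /= andbb shift neq_j.
Qed.

(** Splits off the identity operator [u = 0]; the rest is indexed like the rows and columns of
    [Sfg]. *)
Lemma sum_ord_sqr d (f : nat -> C) : (0 < d)%N ->
  \sum_(u < d * d) f u = f 0 + \sum_(i < d ^ 2 - 1) f i.+1.
Proof.
move=> d_gt0; rewrite -(big_mkord xpredT) /= subn1.
have -> : (d * d = (d ^ 2).-1.+1)%N by rewrite prednK ?expn_gt0 ?d_gt0 // mulnn.
by rewrite big_nat_recl // big_mkord.
Qed.

(** This is the trace of [r] times the adjoint of the [u]-th Pauli operator. *)
Definition paulicoef d (w : C) (r : 'I_d -> 'I_d -> C) (u : nat) : C :=
  \sum_(e : 'I_d * 'I_d) r e.1 e.2 * (pauli d w u e.1 e.2)^*.

Lemma paulicoef0 d (w : C) (r : 'I_d -> 'I_d -> C) :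
  paulicoef w r 0 = \sum_i r i i.
Proof.
rewrite /paulicoef -(pair_bigA _ (fun i j => r i j * (pauli d w 0 i j)^*)) /=.
apply: eq_bigr => i _; rewrite (bigD1 i) //= big1 => [|j /negPf nij].
  by rewrite pauli0E eqxx conjC1 mulr1 addr0.
by rewrite pauli0E nij conjC0 mulr0.
Qed.

Lemma sum_paulicoef d (w : C) (r : 'I_d -> 'I_d -> C) : d.-primitive_root w ->
  \sum_(u < d * d) `|paulicoef w r u| ^+ 2 = d%:R * purity r.
Proof.
move=> w_prim; rewrite (parseval _ (pauli_tight_frame w_prim)); congr (_ * _).
by rewrite /purity (pair_bigA _ (fun i j => `|r i j| ^+ 2)).
Qed.

Lemma sum_paulicoef_traceless d (w : C) (r : 'I_d -> 'I_d -> C) :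
  (0 < d)%N -> d.-primitive_root w -> \sum_i r i i = 1 ->
  \sum_(i < d ^ 2 - 1) `|paulicoef w r i.+1| ^+ 2 = d%:R * purity r - 1.
Proof.
move=> d_gt0 w_prim tr1; rewrite -(sum_paulicoef r w_prim).
rewrite (sum_ord_sqr (fun u => `|paulicoef w r u| ^+ 2)) //.
by rewrite paulicoef0 tr1 normr1 expr1n addrAC subrr add0r.
Qed.

Lemma sum_paulicoef_state_le (K : finType) d (w : C) (x : K -> 'I_d -> C) :
  (0 < d)%N -> d.-primitive_root w -> \sum_i gram x i i = 1 ->
  \sum_(i < d ^ 2 - 1) `|paulicoef w (gram x) i.+1| ^+ 2 <= d%:R - 1.
Proof.
move=> d_gt0 w_prim tr1; rewrite sum_paulicoef_traceless // lerD2r.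
rewrite -[leRHS]mulr1; apply: ler_wpM2l; first exact: ler0n.
by apply: le_trans (purity_gram_le _) _; rewrite tr1 expr1n.
Qed.

(** Nesting, with the second factor innermost, lets the one-factor results apply to each factor in
    turn. *)
Definition paulicoef2 d e (w z : C) (r : 'I_d * 'I_e -> 'I_d * 'I_e -> C)
    (u v : nat) : C :=
  paulicoef w (fun i i' => paulicoef z (fun j j' => r (i, j) (i', j')) v) u.

Lemma paulicoef2C d e (w z : C) (r : 'I_d * 'I_e -> 'I_d * 'I_e -> C) u v :
  paulicoef2 w z r u v =
  paulicoef2 z w (fun p q => r (p.2, p.1) (q.2, q.1)) v u.
Proof.
rewrite /paulicoef2 /paulicoef; under eq_bigr do rewrite mulr_suml.
rewrite exchange_big; apply: eq_bigr => f _ /=.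
by rewrite mulr_suml; apply: eq_bigr => g _; rewrite mulrAC.
Qed.

Lemma sum_paulicoef2 d e (w z : C) (r : 'I_d * 'I_e -> 'I_d * 'I_e -> C) :
  d.-primitive_root w -> e.-primitive_root z ->
  \sum_(u < d * d) \sum_(v < e * e) `|paulicoef2 w z r u v| ^+ 2 =
  d%:R * e%:R * purity r.
Proof.
move=> w_prim z_prim; rewrite exchange_big /=.
under eq_bigr do rewrite sum_paulicoef //.
rewrite -mulr_sumr -mulrA; congr (_ * _).
pose T i j i' j' := `|r (i, j) (i', j')| ^+ 2.
transitivity (e%:R * \sum_i \sum_i' \sum_j \sum_j' T i j i' j').
  rewrite mulr_sumr exchange_big; apply: eq_bigr => i _ /=.
  rewrite mulr_sumr exchange_big; apply: eq_bigr => i' _ /=.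
  by rewrite sum_paulicoef.
congr (_ * _); transitivity (\sum_i \sum_j \sum_q `|r (i, j) q| ^+ 2); last first.
  by rewrite pair_bigA; apply: eq_bigr => -[].
apply: eq_bigr => i _; rewrite exchange_big; apply: eq_bigr => j _ /=.
by rewrite (pair_bigA _ (fun i' j' => T i j i' j')); apply: eq_bigr => -[].
Qed.

(** Index 0 is the identity operator, so it traces out the second factor. *)
Lemma paulicoef2_0r (K : finType) d e (w z : C) (x : K -> 'I_d * 'I_e -> C) u :
  paulicoef2 w z (gram x) u 0 =
  paulicoef w (gram (fun (kf : K * 'I_e) i => x kf.1 (i, kf.2))) u.
Proof. by apply: eq_bigr => i _; rewrite paulicoef0 gram_marginalE. Qed.

Lemma sum_paulicoef2_traceless_le (K : finType) d e (w z : C)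
    (x : K -> 'I_d * 'I_e -> C) :
  (2 <= d)%N -> (2 <= e)%N -> d.-primitive_root w -> e.-primitive_root z ->
  \sum_i gram x i i = 1 ->
  \sum_(i < d ^ 2 - 1) \sum_(j < e ^ 2 - 1) `|paulicoef2 w z (gram x) i.+1 j.+1| ^+ 2
  <= d%:R * e%:R * (1 - (d%:R ^+ 2)^-1 - (e%:R ^+ 2)^-1) + 1.
Proof.
move=> d_ge2 e_ge2 w_prim z_prim tr1.
have d_gt0 : (0 < d)%N by exact: ltnW. have e_gt0 : (0 < e)%N by exact: ltnW.
(* Swapping the factors lets the results that trace out the second factor serve for the first one
   too. *)
pose x' k (p : 'I_e * 'I_d) := x k (p.2, p.1).
pose rd := gram (fun (kf : K * 'I_e) i => x kf.1 (i, kf.2)).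
pose re := gram (fun (kf : K * 'I_d) i => x' kf.1 (i, kf.2)).
have trd : \sum_i rd i i = 1.
  rewrite -tr1; under eq_bigr do rewrite /rd gram_marginalE.
  by rewrite pair_bigA; apply: eq_bigr => -[].
have tre : \sum_i re i i = 1.
  rewrite -tr1; under eq_bigr do rewrite /re gram_marginalE.
  by rewrite exchange_big pair_bigA; apply: eq_bigr => -[].
have purity_swap : purity (gram x') = purity (gram x).
  rewrite /purity (reindex (fun p : 'I_d * 'I_e => (p.2, p.1))); last first.
    by exists (fun p => (p.2, p.1)) => -[].
  apply: eq_bigr => -[i j] _ /=.
  rewrite (reindex (fun p : 'I_d * 'I_e => (p.2, p.1))); last first.
    by exists (fun p => (p.2, p.1)) => -[].
  by apply: eq_bigr => -[].
set Q := purity (gram x) in purity_swap.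
have Q_ge0 : 0 <= Q by apply: sumr_ge0 => i _; apply: sum_normsq_ge0.
have Q_le1 : Q <= 1 by apply: le_trans (purity_gram_le _) _; rewrite tr1 expr1n.
have Qd : Q <= e%:R * purity rd.
  by have := purity_gram_marginal x; rewrite card_ord.
have Qe : Q <= d%:R * purity re.
  by have := purity_gram_marginal x'; rewrite card_ord purity_swap.
set S := \sum_(i < _) _.
(* Remove from the full two-factor sum the row and the column of index 0: they contribute
   [d%:R * purity rd - 1] and [e%:R * purity re - 1], and their common corner contributes 1. *)
have {S}-> : S = d%:R * e%:R * Q - d%:R * purity rd - e%:R * purity re + 1.
  have := sum_paulicoef2 (gram x) w_prim z_prim.
  under eq_bigr do rewrite (sum_ord_sqr
    (fun v => `|paulicoef2 w z (gram x) _ v| ^+ 2)) //.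
  rewrite (sum_ord_sqr (fun u => `|paulicoef2 w z (gram x) u 0| ^+ 2 +
    \sum_(j < e ^ 2 - 1) `|paulicoef2 w z (gram x) u j.+1| ^+ 2)) //.
  rewrite big_split /= -/S.
  have -> : paulicoef2 w z (gram x) 0 0 = 1.
    by rewrite paulicoef2_0r paulicoef0.
  under eq_bigr do rewrite paulicoef2C -[fun p q => _]/(gram x') paulicoef2_0r.
  rewrite (sum_paulicoef_traceless _ z_prim) //.
  under [X in _ + (X + _)]eq_bigr do rewrite paulicoef2_0r.
  rewrite (sum_paulicoef_traceless _ w_prim) // normr1 -/rd -/re => <-.
  ring.
have d_neq0 : d%:R != 0 :> C by rewrite pnatr_eq0 -lt0n.
have e_neq0 : e%:R != 0 :> C by rewrite pnatr_eq0 -lt0n.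
have Pd : Q / e%:R <= purity rd by rewrite ler_pdivrMr ?ltr0n // mulrC.
have Pe : Q / d%:R <= purity re by rewrite ler_pdivrMr ?ltr0n // mulrC.
rewrite lerD2r.
apply: (@le_trans _ _ (d%:R * e%:R * Q - d%:R * (Q / e%:R) - e%:R * (Q / d%:R))).
  by apply: lerB; [apply: lerB => // |]; apply: ler_wpM2l; rewrite ?ler0n.
have -> : d%:R * e%:R * Q - d%:R * (Q / e%:R) - e%:R * (Q / d%:R) =
   d%:R * e%:R * (1 - (d%:R ^+ 2)^-1 - (e%:R ^+ 2)^-1) * Q.
  by field; rewrite d_neq0 e_neq0.
(* Replacing [Q] by 1 needs a nonnegative factor; dimensions at least 2 make each inverse square at
   most 1/2. *)
rewrite -[leRHS]mulr1; apply: ler_wpM2l => //; apply: mulr_ge0.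
  by rewrite mulr_ge0 ?ler0n.
have half k : (2 <= k)%N -> (k%:R ^+ 2)^-1 <= 2^-1 :> C.
  move=> k_ge2; rewrite lef_pV2 ?posrE ?exprn_gt0 ?ltr0n // ?(ltnW k_ge2) //.
  by rewrite -natrX ler_nat (leq_trans k_ge2) // -mulnn leq_pmulr // (ltnW k_ge2).
rewrite -addrA -opprD subr_ge0; apply: le_trans (lerD (half _ d_ge2) (half _ e_ge2)) _.
by rewrite [X in _ <= X]splitr mul1r.
Qed.

End PauliCoefficients.


(** * Tensor positions permuted by [s], and the bound for separable states *)

Lemma big_ord3 (T : Type) (idx : T) (op : Monoid.law idx) (F : 'I_3 -> T) :
  \big[op/idx]_i F i = op (F 0) (op (F 1) (F 2)).
Proof.
rewrite !big_ord_recl big_ord0 Monoid.mulm1.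
by congr (op (F _) (op (F _) (F _))); apply: val_inj.
Qed.

Section Bipartition.
Variable C : numClosedFieldType.
Variables (d1 d2 d3 : nat) (w1 w2 w3 : C) (s : 'S_3).
Local Notation dimk := (dimk d1 d2 d3).
Local Notation compk := (@compk d1 d2 d3).
Local Notation rootk p := (nth 0 [:: w1; w2; w3] p).

(** Natural-number indices avoid transport between the ordinal types of permuted positions. *)
Definition pauli_entry (d : nat) (w : C) (u m n : nat) : C :=
  if n == ((m + u %% d) %% d)%N then w ^+ (u %/ d * m) else 0.

Lemma forall_ord3 (P : 'I_3 -> Prop) : P 0 -> P 1 -> P 2 -> forall p, P p.
Proof.
by move=> P0 P1 P2 [[|[|[|//]]] lt]; [move: P0|move: P1|move: P2];
  congr P; apply: val_inj.
Qed.

Lemma compk_lt (p : 'I_3) x : (compk p x < dimk p)%N.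
Proof. by move: p; apply: forall_ord3 => /=; exact: ltn_ord. Qed.

Definition comp_ord (p : 'I_3) x : 'I_(dimk p) := Ordinal (compk_lt p x).

(** An entry of a tensor product is a commutative product over positions, so it can be reindexed by
    [s]. *)
Lemma coefpE (rho : 'M[C]_(d1 * d2 * d3)) uf ug uh :
  Defs.coefp w1 w2 w3 rho s uf ug uh =
  \sum_x \sum_y rho x y * \prod_(q < 3)
    (pauli_entry (dimk (s q)) (rootk (s q)) (nth 0%N [:: uf; ug; uh] q)
       (compk (s q) x) (compk (s q) y))^*.
Proof.
pose upos (p : 'I_3) := if s 0 == p then uf else if s 1 == p then ug else uh.
change (Defs.coefp _ _ _ _ _ _ _ _) with (coef w1 w2 w3 rho (upos 0) (upos 1) (upos 2)).
have uposE q : upos (s q) = nth 0%N [:: uf; ug; uh] q.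
  by move: q; apply: forall_ord3; rewrite /upos !(inj_eq perm_inj).
apply: eq_bigr => x _; rewrite mxE; apply: eq_bigr => y _; congr (_ * _).
transitivity (\prod_(p < 3) (pauli_entry (dimk p) (rootk p) (upos p)
       (compk p x) (compk p y))^*).
  by rewrite big_ord3 /= !mxE mulrA.
by rewrite (reindex_perm s); apply: eq_bigr => q _; rewrite uposE.
Qed.

Definition split_index x : 'I_(dimk (s 0)) * ('I_(dimk (s 1)) * 'I_(dimk (s 2))) :=
  (comp_ord (s 0) x, (comp_ord (s 1) x, comp_ord (s 2) x)).

(** Since [s] reaches every position, the components determine the index; permuting the dimensions
    preserves their product, so cardinalities agree. *)
Lemma split_index_bij : bijective split_index.
Proof.
apply: inj_card_bij => [x y [e0 e1 e2]|].
  have {e0 e1 e2} e q : compk (s q) x = compk (s q) y.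
    by move: q; apply: forall_ord3.
  have {}e (p : 'I_3) : compk p x = compk p y by have := e ((s^-1)%g p); rewrite permKV.
  have := e 0; have := e 1; have := e 2; rewrite /Defs.compk /= => e2 e1 e0.
  rewrite -[x]mxtens_unindexK -[y]mxtens_unindexK; congr mxtens_index.
  congr (_, _); last exact: val_inj.
  rewrite -[LHS]mxtens_unindexK -[RHS]mxtens_unindexK; congr mxtens_index.
  by congr (_, _); apply: val_inj.
have -> : (d1 * d2 * d3 = \prod_(p < 3) dimk p)%N.
  by rewrite big_ord3 /= mulnA.
by rewrite (reindex_perm s) big_ord3 !card_prod !card_ord.
Qed.

Lemma mxnat_ord n (M : 'M[C]_n) (i j : 'I_n) : mxnat M i j = M i j.
Proof. by rewrite /mxnat !valK. Qed.

Local Notation wf := (rootk (s 0)).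
Local Notation wg := (rootk (s 1)).
Local Notation wh := (rootk (s 2)).

Lemma coefp_prodop (A : 'M[C]_(dimk (s 0))) (B : 'M_(dimk (s 1) * dimk (s 2)))
    uf ug uh :
  Defs.coefp w1 w2 w3 (prodop (s := s) A B) s uf ug uh =
  paulicoef wf (fun i j => A i j) uf *
  paulicoef2 wg wh (fun p q => B (mxtens_index p) (mxtens_index q)) ug uh.
Proof.
rewrite coefpE.
pose T (p q : 'I_(dimk (s 0)) * ('I_(dimk (s 1)) * 'I_(dimk (s 2)))) :=
  A p.1 q.1 * B (mxtens_index p.2) (mxtens_index q.2) *
  ((pauli _ wf uf p.1 q.1)^* * (pauli _ wg ug p.2.1 q.2.1)^* *
   (pauli _ wh uh p.2.2 q.2.2)^*).
transitivity (\sum_p \sum_q T p q).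
  rewrite (reindex _ (onW_bij _ split_index_bij)) /=; apply: eq_bigr => x _.
  rewrite (reindex _ (onW_bij _ split_index_bij)) /=; apply: eq_bigr => y _.
  by rewrite big_ord3 /T !mxE -!mxnat_ord /= -!mulrA.
(* Bringing the row and column index of each factor together matches the nesting of [paulicoef] and
   [paulicoef2]. *)
transitivity (\sum_i \sum_i' \sum_j \sum_j' \sum_k \sum_k'
    T (i, (j, k)) (i', (j', k'))).
  transitivity (\sum_i \sum_b \sum_i' \sum_b' T (i, b) (i', b')).
    rewrite [RHS]pair_bigA; apply: eq_bigr => -[i b] _ /=.
    by rewrite [RHS]pair_bigA; apply: eq_bigr => -[].
  apply: eq_bigr => i _; rewrite exchange_big; apply: eq_bigr => i' _ /=.
  transitivity (\sum_j \sum_k \sum_j' \sum_k' T (i, (j, k)) (i', (j', k'))).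
    rewrite [RHS]pair_bigA; apply: eq_bigr => -[j k] _ /=.
    by rewrite [RHS]pair_bigA; apply: eq_bigr => -[].
  by apply: eq_bigr => j _; rewrite exchange_big.
rewrite /paulicoef2 /paulicoef big_distrlr /= pair_bigA /=.
apply: eq_bigr => -[i i'] _ /=; rewrite pair_bigA /=.
apply: eq_bigr => -[j j'] _ /=; rewrite pair_bigA /= mulr_suml mulr_sumr.
by apply: eq_bigr => -[k k'] _; rewrite /T /=; ring.
Qed.

Hypothesis d_ge2 : forall p : 'I_3, (2 <= dimk p)%N.
Hypothesis w_prim : forall p : 'I_3, (dimk p).-primitive_root (rootk p).

Local Notation df := (dimk (s 0)).
Local Notation dg := (dimk (s 1)).
Local Notation dh := (dimk (s 2)).

Lemma coefp_sum n (p : 'I_n -> C) (r : 'I_n -> 'M[C]_(d1 * d2 * d3)) uf ug uh :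
  Defs.coefp w1 w2 w3 (\sum_k p k *: r k) s uf ug uh =
  \sum_k p k * Defs.coefp w1 w2 w3 (r k) s uf ug uh.
Proof.
rewrite /Defs.coefp /coef mulmx_suml raddf_sum; apply: eq_bigr => k _ /=.
by rewrite -scalemxAl linearZ.
Qed.

(** One dual witness [W], taken for the whole matrix, is tested on each rank-one term of the
    mixture; the weights [p k] then average the bounds. *)
Lemma trace_norm_separable_le (rho : 'M[C]_(d1 * d2 * d3)) (alpha beta t : C) :
  separable_fgh rho s -> is_trace_norm (Nmat w1 w2 w3 rho s alpha beta) t ->
  t <= sqrtC (df%:R - 1) *
    (`|alpha| * sqrtC (dg%:R - 1) +
     `|beta| * sqrtC (dg%:R * dh%:R * (1 - (dg%:R ^+ 2)^-1 - (dh%:R ^+ 2)^-1) + 1)).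
Proof.
case=> n [p [A [B [p_gt0 p_sum A_dens B_dens ->]]]].
move=> /trace_norm_dual[W [t_ge0 t_def W_le]].
pose T k u v := paulicoef2 wg wh
  (fun x y => B k (mxtens_index x) (mxtens_index y)) u v.
pose a k : 'cV_(df ^ 2 - 1) := \col_i paulicoef wf (fun i j => A k i j) i.+1.
pose x k : 'rV_((dg ^ 2 - 1) * (dh ^ 2 - 1)) :=
  \row_c (if (c < dg ^ 2 - 1)%N then T k c.+1 0 else 0).
pose y k : 'rV_((dg ^ 2 - 1) * (dh ^ 2 - 1)) :=
  \row_c T k (mxtens_unindex c).1.+1 (mxtens_unindex c).2.+1.
have gt0 q : (0 < dimk (s q))%N by exact: ltnW.
have sub1_gt0 q : (0 < dimk (s q) ^ 2 - 1)%N.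
  by rewrite subn_gt0 -mulnn (leq_trans (d_ge2 (s q))) // leq_pmulr.
have N_def : Nmat w1 w2 w3 (\sum_k p k *: prodop (s := s) (A k) (B k)) s alpha beta =
    \sum_k p k *: (alpha *: (a k *m x k) + beta *: (a k *m y k)).
  apply/matrixP => i c; rewrite summxE !mxE.
  under [RHS]eq_bigr do rewrite !mxE !big_ord1 !mxE mulrDr.
  rewrite big_split /=; congr (_ + _).
    case: ltnP => _; last by rewrite mulr0 big1 // => k _; rewrite !mulr0.
    rewrite coefp_sum mulr_sumr; apply: eq_bigr => k _.
    by rewrite coefp_prodop mulrCA.
  rewrite coefp_sum mulr_sumr; apply: eq_bigr => k _.
  by rewrite coefp_prodop mulrCA.
have a_le k : sqrtC (\sum_i `|a k i 0| ^+ 2) <= sqrtC (df%:R - 1).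
  have [A_psd A_tr] := A_dens k; have [z zE] := psdmx_gram A_psd.
  rewrite ler_sqrtC ?nnegrE ?sum_normsq_ge0 ?subr_ge0 ?ler1n ?gt0 //.
  have := @sum_paulicoef_state_le C _ _ wf z (gt0 0) (w_prim _).
  rewrite -[X in X = 1 -> _](eq_bigr _ (fun i _ => zE i i)) => /(_ A_tr).
  apply: le_trans; rewrite le_eqVlt; apply/orP; left; apply/eqP.
  apply: eq_bigr => i _; rewrite mxE; congr (`|_| ^+ 2).
  by apply: eq_bigr => e _; rewrite zE.
have B_gram k : exists z : 'I_(dg * dh) -> 'I_dg * 'I_dh -> C,
    [/\ \sum_i gram z i i = 1 &
      forall u v, T k u v = paulicoef2 wg wh (gram z) u v].
  have [B_psd B_tr] := B_dens k; have [z zE] := psdmx_gram B_psd.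
  exists (fun l e => z l (mxtens_index e)); split.
    rewrite -B_tr /mxtrace (reindex _ (onW_bij _ (mxtens_index_bij _ _))) /=.
    by apply: eq_bigr => e _; rewrite zE.
  move=> u v; rewrite /T /paulicoef2 /paulicoef.
  apply: eq_bigr => e _; congr (_ * _); apply: eq_bigr => f _.
  by rewrite zE.
have x_le k : sqrtC (\sum_c `|x k 0 c| ^+ 2) <= sqrtC (dg%:R - 1).
  have [z [z_tr zE]] := B_gram k.
  rewrite ler_sqrtC ?nnegrE ?sum_normsq_ge0 ?subr_ge0 ?ler1n ?gt0 //.
  (* The zero padding contributes nothing, and [dh ^ 2 - 1 > 0] ensures that all [dg ^ 2 - 1]
     entries fit. *)
  have -> : \sum_c `|x k 0 c| ^+ 2 = \sum_(i < dg ^ 2 - 1) `|T k i.+1 0| ^+ 2.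
    rewrite (big_ord_widen ((dg ^ 2 - 1) * (dh ^ 2 - 1))
      (fun i => `|T k i.+1 0| ^+ 2)) ?leq_pmulr // [RHS]big_mkcond.
    apply: eq_bigr => c _; rewrite mxE.
    by case: ifP; rewrite ?normr0 ?expr0n.
  under eq_bigr do rewrite zE paulicoef2_0r.
  apply: sum_paulicoef_state_le => //.
  rewrite -z_tr; under eq_bigr do rewrite gram_marginalE.
  by rewrite pair_bigA; apply: eq_bigr => -[].
set Y := dg%:R * dh%:R * _ + 1.
have y_le k : sqrtC (\sum_c `|y k 0 c| ^+ 2) <= sqrtC Y.
  have [z [z_tr zE]] := B_gram k.
  have yY : \sum_c `|y k 0 c| ^+ 2 <= Y.
    apply: le_trans (sum_paulicoef2_traceless_le
      (d_ge2 (s 1)) (d_ge2 (s 2)) (w_prim _) (w_prim _) z_tr).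
    rewrite le_eqVlt; apply/orP; left; apply/eqP.
    rewrite (reindex _ (onW_bij _ (mxtens_index_bij _ _))) /= pair_bigA.
    by apply: eq_bigr => e _; rewrite mxE mxtens_indexK zE.
  by rewrite ler_sqrtC ?nnegrE ?sum_normsq_ge0 // (le_trans (sum_normsq_ge0 _) yY).
have ax_le k : `|\tr (a k *m x k *m W)| <= sqrtC (df%:R - 1) * sqrtC (dg%:R - 1).
  apply: le_trans (W_le _ _) _.
  by apply: ler_pM; rewrite ?sqrtC_ge0 ?sum_normsq_ge0.
have ay_le k : `|\tr (a k *m y k *m W)| <= sqrtC (df%:R - 1) * sqrtC Y.
  apply: le_trans (W_le _ _) _.
  by apply: ler_pM; rewrite ?sqrtC_ge0 ?sum_normsq_ge0.
rewrite -(ger0_norm t_ge0) t_def N_def mulmx_suml raddf_sum /=.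
apply: le_trans (ler_norm_sum _ _ _) _.
(* Writing 1 as the sum of the weights reduces the bound to one product state at a time. *)
rewrite -[leRHS]mul1r -[X in X * _]p_sum mulr_suml; apply: ler_sum => k _.
rewrite -scalemxAl linearZ /= normrM (gtr0_norm (p_gt0 k)).
apply: ler_wpM2l; first exact: ltW.
rewrite mulmxDl -!scalemxAl linearD !linearZ /= mulrDr !(mulrCA (sqrtC (df%:R - 1))).
apply: le_trans (ler_normD _ _) _; rewrite !normrM.
by apply: lerD; apply: ler_wpM2l.
Qed.

End Bipartition.

Theorem theorem1 (R : rcfType) (d1 d2 d3 : nat) (w1 w2 w3 : R[i])
    (rho : 'M[R[i]]_(d1 * d2 * d3)) (s : 'S_3) (alpha beta : R) :
  (2 <= d1)%N -> (2 <= d2)%N -> (2 <= d3)%N ->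
  d1.-primitive_root w1 -> d2.-primitive_root w2 -> d3.-primitive_root w3 ->
  density rho ->
  separable_fgh rho s ->
  let df := dimk d1 d2 d3 (s 0) in
  let dg := dimk d1 d2 d3 (s 1) in
  let dh := dimk d1 d2 d3 (s 2) in
  forall t : R[i],
    is_trace_norm (Nmat w1 w2 w3 rho s (alpha%:C)%C (beta%:C)%C) t ->
    t <= sqrtC (df%:R - 1) *
         ((`|alpha|)%:C%C * sqrtC (dg%:R - 1) +
          (`|beta|)%:C%C * sqrtC (dg%:R * dh%:R * (1 - (dg%:R ^+ 2)^-1 - (dh%:R ^+ 2)^-1) + 1)).
Proof.
move=> d1_ge2 d2_ge2 d3_ge2 w1_prim w2_prim w3_prim _ rho_sep df dg dh t t_norm.
have normC_real (c : R) : (`|c|%:C)%C = `|(c%:C)%C|.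
  by rewrite normc_def /= expr0n addr0 sqrtr_sqr.
rewrite !normC_real; apply: (trace_norm_separable_le _ _ rho_sep t_norm).
  exact: forall_ord3.
exact: forall_ord3.
Qed.
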